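(* Let $\mathcal{X}$ be a curve of genus $g$ over $\mathbb{F}_q$, let $Q,P_1,\dots,P_n$ be distinct rational points of $\mathcal{X}$ with $n>2g+2$, let $D=P_1+\dots+P_n$, and let $1\le\delta\le n$ be an integer. Assume the sequence $(C(D,m_iQ))_{i=0,\dots,n}$ satisfies the isometry-dual condition. Then: (1) For every choice of functions $f_1,\dots,f_n\in\mathcal{L}(\infty Q)$ with $v(f_i)=m_i$ for all $i$, there exist functions $f_1',\dots,f_n'\in\mathcal{L}(\infty Q)$ with $v(f_i')=m_i$ for all $i$, such that the code $\tilde{C}(D,Q,\delta)$ defined from $\{f_1,\dots,f_n\}$ is isometric to the code $C(D,Q,\delta)$ defined from $\{f'_1,\dots,f'_n\}$. (2) For every choice of functions $f_1,\dots,f_n\in\mathcal{L}(\infty Q)$ with $v(f_i)=m_i$ for all $i$, there exist functions $f_1',\dots,f_n'\in\mathcal{L}(\infty Q)$ with $v(f_i')=m_i$ for all $i$, such that the code $C(D,Q,\delta)$ defined from $\{f_1,\dots,f_n\}$ is isometric to the code $\tilde{C}(D,Q,\delta)$ defined from $\{f'_1,\dots,f'_n\}$.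
   Context: ''Curve'' means projective, non-singular, geometrically irreducible algebraic curve. For a divisor $E$, $\mathcal{L}(E)$ is its Riemann–Roch space. Let $v=-v_Q$, where $v_Q$ is the valuation at $Q$, and $\mathcal{L}(\infty Q)=\bigcup_{r\ge 0}\mathcal{L}(rQ)$. The evaluation map is $ev:\mathcal{L}(\infty Q)\to\mathbb{F}_q^n$, $ev(f)=(f(P_1),\dots,f(P_n))$, and $C(D,mQ)=ev(\mathcal{L}(mQ))$ (so $C(D,-Q)=(0)$). Let $H=H(Q)=\{v(f): f\in\mathcal{L}(\infty Q)\setminus\{0\}\}$ and $H^*=\{m\in\mathbb{N}_0 : C(D,mQ)\neq C(D,(m-1)Q)\}$; $H^*$ has exactly $n$ elements, written $m_1<m_2<\dots<m_n$. Put $m_0=-1$, so $C(D,m_0Q)=(0)$. For $\mathbf{x}\in(\mathbb{F}_q^* )^n$ (all coordinates non-zero) let $\chi_{\mathbf{x}}:\mathbb{F}_q^n\to\mathbb{F}_q^n$, $\chi_{\mathbf{x}}(\mathbf{v})=(x_1v_1,\dots,x_nv_n)$. Two linear codes $C,C'\subseteq\mathbb{F}_q^n$ are isometric if $\chi_{\mathbf{x}}(C)=C'$ for some $\mathbf{x}\in(\mathbb{F}_q^* )^n$. A sequence of codes $(C_i)_{i=0,\dots,n}$ in $\mathbb{F}_q^n$ (with $C_0\subset C_1\subset\dots\subset C_n$, $\dim C_i=i$) satisfies the isometry-dual condition if there is $\mathbf{x}\in(\mathbb{F}_q^* )^n$ with $\chi_{\mathbf{x}}(C_i)=C_{n-i}^\perp$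 for all $i=0,\dots,n$. Let $\Lambda_i^*=\{m\in H^* : m=m_i+m_j \text{ for some } m_j\in H^*\}$ (equivalently $(m_i+H)\cap H^*$) for $i=1,\dots,n$, and for $h\in H$ let $A[h]=\{t\in H : h-t\in H\}$. Given functions $f_1,\dots,f_n\in\mathcal{L}(\infty Q)$ with $v(f_i)=m_i$, the improved codes defined from them are $$C(D,Q,\delta)=\langle\{ev(f_i) : \#\Lambda_i^*\ge\delta\}\rangle,\qquad \tilde{C}(D,Q,\delta)=\langle\{ev(f_i) : \#A[m_i]<\delta\}\rangle^\perp .$$ *)

(* Defs.v *)
From HB Require Import structures.
From mathcomp Require Import all_boot all_order all_algebra.
From mathcomp Require Import finmap.
From mathcomp Require Import all_classical.

Set Implicit Arguments.
Unset Strict Implicit.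
Unset Printing Implicit Defensive.

Import Order.TTheory GRing.Theory Num.Theory.
Local Open Scope classical_set_scope.
Local Open Scope ring_scope.

(* A projective non-singular geometrically irreducible curve over the finite  *)
(* field K is given by its function field F, with embedding iota : K -> F.    *)
(* The closed points of the curve are the discrete valuations of F / K        *)
(* (Hartshorne, Algebraic Geometry, I.6; Stichtenoth, Algebraic Function      *)
(* Fields and Codes, Ch. 1 and App. B).                                       *)

(* K(x) *)
Definition simple_subfield (K : finFieldType) (F : fieldType)
    (iota : {rmorphism K -> F}) (x : F) : set F :=
  [set z | exists p q : {poly K}, (map_poly iota q).[x] != 0 /\
     z = (map_poly iota p).[x] / (map_poly iota q).[x]].

(* As K is perfect, geometric irreducibility amounts to K being algebraically *)
(* closed in F.                                                               *)
Definition curve (K : finFieldType) (F : fieldType)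
    (iota : {rmorphism K -> F}) : Prop :=
  (exists x : F, ~ algebraicOver iota x /\
     exists (d : nat) (y : 'I_d -> F), forall z : F, exists r : 'I_d -> F,
       (forall i, simple_subfield iota x (r i)) /\ z = \sum_i r i * y i) /\
  (forall x : F, algebraicOver iota x -> exists c : K, x = iota c).

(* The value at 0, where a valuation is infinite, is set to 0, so that two    *)
(* points with the same valuation are equal.                                  *)
Record closed_point (K : finFieldType) (F : fieldType)
    (iota : {rmorphism K -> F}) :=
  ClosedPoint {
    val_at :> F -> int;
    val_at0 : val_at 0 = 0;
    val_atM : forall x y, x != 0 -> y != 0 ->
      val_at (x * y) = val_at x + val_at y;
    val_atD : forall x y, x != 0 -> y != 0 -> x + y != 0 ->
      Num.min (val_at x) (val_at y) <= val_at (x + y);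
    val_at_const : forall c : K, c != 0 -> val_at (iota c) = 0;
    val_at_unif : exists2 t, t != 0 & val_at t = 1
  }.

HB.instance Definition _ (K : finFieldType) (F : fieldType)
  (iota : {rmorphism K -> F}) := gen_eqMixin (closed_point iota).
HB.instance Definition _ (K : finFieldType) (F : fieldType)
  (iota : {rmorphism K -> F}) := gen_choiceMixin (closed_point iota).

(* dim_K (V / W), for K-subspaces W of V; 0 when it is infinite *)
Definition quo_dim (K : finFieldType) (F : fieldType)
    (iota : {rmorphism K -> F}) (V W : set F) : nat :=
  xget 0%N [set d | exists e : 'I_d -> F, (forall i, V (e i)) /\
    forall z, V z -> exists! c : 'rV[K]_d, W (z - \sum_i iota (c 0 i) * e i)].

Definition local_ring (K : finFieldType) (F : fieldType)
    (iota : {rmorphism K -> F}) (P : closed_point iota) : set F :=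
  [set f | f = 0 \/ 0 <= P f].

Definition max_ideal (K : finFieldType) (F : fieldType)
    (iota : {rmorphism K -> F}) (P : closed_point iota) : set F :=
  [set f | f = 0 \/ 0 < P f].

Definition degp (K : finFieldType) (F : fieldType)
    (iota : {rmorphism K -> F}) (P : closed_point iota) : nat :=
  quo_dim iota (local_ring P) (max_ideal P).

Definition rational (K : finFieldType) (F : fieldType)
    (iota : {rmorphism K -> F}) (P : closed_point iota) : Prop := degp P = 1%N.

(* f(P), for P rational and f regular at P *)
Definition eval_at (K : finFieldType) (F : fieldType)
    (iota : {rmorphism K -> F}) (P : closed_point iota) (f : F) : K :=
  xget 0 [set c | max_ideal P (f - iota c)].

Definition divisor (K : finFieldType) (F : fieldType)
    (iota : {rmorphism K -> F}) : Type :=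
  {fsfun closed_point iota -> int with 0}.

Definition deg (K : finFieldType) (F : fieldType)
    (iota : {rmorphism K -> F}) (E : divisor iota) : int :=
  \sum_(P <- finsupp E) E P * (degp P)%:Z.

Definition RRspace (K : finFieldType) (F : fieldType)
    (iota : {rmorphism K -> F}) (E : divisor iota) : set F :=
  [set f | f = 0 \/ forall P, - E P <= P f].

Definition ell (K : finFieldType) (F : fieldType)
    (iota : {rmorphism K -> F}) (E : divisor iota) : nat :=
  quo_dim iota (RRspace E) [set 0].

(* g is the maximum of deg E - l(E) + 1 over all divisors E *)
Definition genus (K : finFieldType) (F : fieldType)
    (iota : {rmorphism K -> F}) (g : nat) : Prop :=
  (forall E : divisor iota, deg E - (ell E)%:Z + 1 <= g%:Z) /\
  (exists E : divisor iota, deg E - (ell E)%:Z + 1 = g%:Z).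

Definition mulpt (K : finFieldType) (F : fieldType)
    (iota : {rmorphism K -> F}) (m : int) (Q : closed_point iota) :
    divisor iota :=
  [fsfun P in [fset Q]%fset => m | 0].

Definition RRinf (K : finFieldType) (F : fieldType)
    (iota : {rmorphism K -> F}) (Q : closed_point iota) : set F :=
  \bigcup_(r : nat) RRspace (mulpt r%:Z Q).

(* v(f) = k, where v = - v_Q *)
Definition pole_order (K : finFieldType) (F : fieldType)
    (iota : {rmorphism K -> F}) (Q : closed_point iota) (f : F) (k : nat) :
    Prop :=
  f != 0 /\ - Q f = k%:Z.

Definition semigroupH (K : finFieldType) (F : fieldType)
    (iota : {rmorphism K -> F}) (Q : closed_point iota) : set nat :=
  [set k | exists2 f, RRinf Q f & pole_order Q f k].

Definition ev (K : finFieldType) (F : fieldType)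
    (iota : {rmorphism K -> F}) (n : nat) (P : 'I_n -> closed_point iota)
    (f : F) : 'rV[K]_n := \row_i eval_at (P i) f.

(* C(D, mQ), where D is the sum of the points P i *)
Definition code (K : finFieldType) (F : fieldType)
    (iota : {rmorphism K -> F}) (n : nat) (P : 'I_n -> closed_point iota)
    (Q : closed_point iota) (m : int) : set 'rV[K]_n :=
  ev P @` RRspace (mulpt m Q).

Definition Hstar (K : finFieldType) (F : fieldType)
    (iota : {rmorphism K -> F}) (n : nat) (P : 'I_n -> closed_point iota)
    (Q : closed_point iota) : set nat :=
  [set m | code P Q m%:Z <> code P Q (m%:Z - 1)].

(* Indexed from 0: the elements of H^*, in increasing order, are              *)
(* mstar P Q 0 < ... < mstar P Q n.-1.                                        *)
Definition mstar (K : finFieldType) (F : fieldType)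
    (iota : {rmorphism K -> F}) (n : nat) (P : 'I_n -> closed_point iota)
    (Q : closed_point iota) (i : nat) : nat :=
  nth 0%N (sort leq (fset_set (Hstar P Q))) i.

(* C(D, m_i Q) for i = 0, ..., n, with m_0 = -1 *)
Definition code_seq (K : finFieldType) (F : fieldType)
    (iota : {rmorphism K -> F}) (n : nat) (P : 'I_n -> closed_point iota)
    (Q : closed_point iota) (i : nat) : set 'rV[K]_n :=
  code P Q (if i is j.+1 then (mstar P Q j)%:Z else -1).

Definition chi (K : finFieldType) (n : nat) (x v : 'rV[K]_n) : 'rV[K]_n :=
  \row_j (x 0 j * v 0 j).

Definition dual (K : finFieldType) (n : nat) (C : set 'rV[K]_n) :
    set 'rV[K]_n :=
  [set w | forall v, C v -> \sum_j v 0 j * w 0 j = 0].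

Definition isometric (K : finFieldType) (n : nat) (C C' : set 'rV[K]_n) :
    Prop :=
  exists x : 'rV[K]_n, (forall j, x 0 j != 0) /\ chi x @` C = C'.

Definition isometry_dual (K : finFieldType) (n : nat)
    (C : nat -> set 'rV[K]_n) : Prop :=
  exists x : 'rV[K]_n, (forall j, x 0 j != 0) /\
    forall i, (i <= n)%N -> chi x @` C i = dual (C (n - i)%N).

Definition Lambda_star (K : finFieldType) (F : fieldType)
    (iota : {rmorphism K -> F}) (n : nat) (P : 'I_n -> closed_point iota)
    (Q : closed_point iota) (i : 'I_n) : set nat :=
  [set m | Hstar P Q m /\ exists2 h, Hstar P Q h & m = (mstar P Q i + h)%N].

Definition Aset (K : finFieldType) (F : fieldType)
    (iota : {rmorphism K -> F}) (Q : closed_point iota) (h : nat) : set nat :=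
  [set t | semigroupH Q t /\ exists2 s, semigroupH Q s & h = (t + s)%N].

Definition adapted (K : finFieldType) (F : fieldType)
    (iota : {rmorphism K -> F}) (n : nat) (P : 'I_n -> closed_point iota)
    (Q : closed_point iota) (f : 'I_n -> F) : Prop :=
  forall i, RRinf Q (f i) /\ pole_order Q (f i) (mstar P Q i).

Definition improved_code (K : finFieldType) (F : fieldType)
    (iota : {rmorphism K -> F}) (n : nat) (P : 'I_n -> closed_point iota)
    (Q : closed_point iota) (f : 'I_n -> F) (delta : nat) : set 'rV[K]_n :=
  [set` <<[seq ev P (f i) | i : 'I_n <- enum 'I_n &
             (delta <= #|` fset_set (Lambda_star P Q i)|)%N]>>%VS].

Definition improved_dual_code (K : finFieldType) (F : fieldType)
    (iota : {rmorphism K -> F}) (n : nat) (P : 'I_n -> closed_point iota)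
    (Q : closed_point iota) (f : 'I_n -> F) (delta : nat) : set 'rV[K]_n :=
  dual [set` <<[seq ev P (f i) | i : 'I_n <- enum 'I_n &
                  (#|` fset_set (Aset Q (mstar P Q i))| < delta)%N]>>%VS].

(* Main.v *)
Require Import Defs.
From HB Require Import structures.
From mathcomp Require Import all_boot all_order all_algebra.
From mathcomp Require Import finmap.
From mathcomp Require Import all_classical.
From mathcomp Require Import zify.

Set Implicit Arguments.
Unset Strict Implicit.
Unset Printing Implicit Defensive.

Import Order.TTheory GRing.Theory Num.Theory.

(* Let [x] realize the isometry-dual condition, let [phi h] be the sum of the *)
(* [x_i h(P_i)], and let [form u v] be the sum of the [x_i u_i v_i], so that  *)
(* [form (ev f) (ev h) = phi (f h)] and the codes [C_i], [C_(n-i)] are        *)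
(* mutually orthogonal for [form]. Let [gam <= g] be the number of gaps of    *)
(* [H]. Every element of [H] up to [n + 2 gam - 2] is the sum of an element   *)
(* of [H] up to [2 gam] and one up to [n - 2], so [phi] vanishes on [L((n + 2 *)
(* gam - 2) Q)], whence [m_n >= n + 2 gam - 1]. Since [phi f <> 0] when [v(f) *)
(* = m_n], two elements of [H^*] with sum [m_n] have complementary indices,   *)
(* and [H^*] is then seen to be symmetric: [m_i + m_(n+1-i) = m_n]. As [H \   *)
(* H^*] is an ideal of [H], adding [m_i] maps [A[m_(n+1-i)]] onto             *)
(* [Lambda^*_i]. Finally the basis dual to the [ev f_i] for [form] is again   *)
(* triangular for the flag of codes, so it has the form [ev f'_i], and        *)
(* duality exchanges the two improved codes.                                  *)
(*   The only input on the curve is Riemann's inequality [l(E) >= deg E + 1 - *)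
(* g], which is built into the definition of the genus.                       *)

(** The argument has a combinatorial half and a linear half. The combinatorial half is
    [card_Lambda_star]: the sets Lambda^*_i and A[m_(n+1-i)] have the same size. It rests on the
    symmetry [mstar_compl] of H^*, which follows from the lower bound [top_ge] on m_n (through
    [semigroup_split] and [phi_eq0]), from [cnt_add_top], and from the ideal property [hstarM]. The
    linear half is [dual_adapted] with [chi_span_dual]: the dual basis of an adapted basis, taken in
    reverse order, is adapted, and the orthogonal of a part of one basis is spanned by the
    complementary part of the other. On the curve, Riemann's inequality enters as [genus_basis] and
    yields [zeros_le_poles]; [L_ind] reduces linear claims on L(mQ) to one function for each pole
    order. *)

Section NumericalSemigroup.

Variable H : pred nat.
Hypothesis H0 : H 0.
Hypothesis HD : forall a b, H a -> H b -> H (a + b).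

Definition gaps (u v : nat) : nat := \sum_(u <= i < v) ~~ H i.

Lemma gaps_cat u v w : u <= v -> v <= w -> gaps u w = gaps u v + gaps v w.
Proof. exact: big_cat_nat. Qed.

Lemma count_gaps m : count H (index_iota 0 m) + gaps 0 m = m.
Proof.
rewrite -sum1_count big_mkcond -big_split /= -[RHS]subn0 -[RHS]muln1.
by rewrite -sum_nat_const_nat; apply: eq_bigr => i _; case: (H i).
Qed.

(** The reflection [a -> u + v - 1 - a] of the interval sends each element of H to a gap, so at
    least half of the interval consists of gaps. *)
Lemma leq_gaps_paired u v :
  (forall a, u <= a < v -> ~~ (H a && H (u + v - a.+1))) ->
  v - u <= 2 * gaps u v.
Proof.
move=> noHH; rewrite mul2n -addnn {2}/gaps big_nat_rev /= -big_split /=.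
rewrite -[leqLHS]muln1 -sum_nat_const_nat big_nat [leqRHS]big_nat.
by apply: leq_sum => a /noHH; rewrite negb_and; case: (H a) => //= ->.
Qed.

Variable g : nat.
Hypothesis gaps_le : forall m, gaps 0 m <= g.

(** If t is a gap, then a and t - a are never both in H, so at least half of the t + 1 numbers up to
    t are gaps, whence t + 1 <= 2g. *)
Lemma semigroup_conductor t : 2 * g <= t -> H t.
Proof.
move=> le_t; apply: contraT => Ht.
have := @leq_gaps_paired 0 t.+1; have := gaps_le t.+1.
suff noHH a : 0 <= a < t.+1 -> ~~ (H a && H (0 + t.+1 - a.+1)).
  by move=> ? /(_ noHH); lia.
move=> lt_a; apply: contra Ht => /andP[Ha inH].
have -> : t = a + (0 + t.+1 - a.+1) by lia.
exact: HD.
Qed.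

Lemma gaps_stable m : 2 * g <= m -> gaps 0 m = gaps 0 (2 * g).
Proof.
move=> le_m; rewrite (gaps_cat _ le_m)// [X in _ + X]/gaps.
rewrite big_nat big1 ?addn0// => i /andP[le_i _].
by rewrite semigroup_conductor.
Qed.

(* A numerical counterpart of the surjectivity of the multiplication map      *)
(* [L(2gQ) (x) L((2g+1)Q) -> L((4g+1)Q)].                                     *)
Lemma semigroup_split_small t : 2 * g + 1 < t -> t <= 4 * g + 1 ->
  exists a b, [/\ H a, H b, t = a + b, a <= 2 * g & b <= 2 * g + 1].
Proof.
move=> lt_t le_t; set u := t - (2 * g + 1).
have [Hu|Hu] := boolP (H u).
  exists u, (2 * g + 1).
  by split=> //; [apply: semigroup_conductor|..]; rewrite /u; lia.
(* Both summands are sought between u and 2g + 1, an interval reflected by [a -> t - a]. If there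
   are none, half of it consists of gaps; so does half of the interval from 1 to u - 1, as u is a
   gap. This makes more than g gaps. *)
have : exists2 a, u <= a < 2 * g + 2 & H a && H (u + (2 * g + 2) - a.+1).
  apply: contrapT => no.
  have le1 : 2 * g + 2 - u <= 2 * gaps u (2 * g + 2).
    by apply: leq_gaps_paired => a ra; apply/negP => HH; apply: no; exists a.
  have le2 : u - 1 <= 2 * gaps 1 u.
    apply: leq_gaps_paired => a ra; apply: contra Hu => /andP[Ha inH].
    have -> : u = a + (1 + u - a.+1) by lia.
    exact: HD.
  have le3 : gaps 0 1 + (gaps 1 u + gaps u (2 * g + 2)) <= g.
    by rewrite -!gaps_cat ?gaps_le//; rewrite /u; lia.
  have uE : u = t - (2 * g + 1) by [].
  by move: (gaps 0 1) (gaps 1 u) (gaps u _) le1 le2 le3 => x y z; lia.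
case=> a ra /andP[Ha]; set b := _ - _ => inH.
have [le_a|lt_a] := leqP a (2 * g).
  by exists a, b; split=> //; rewrite /b /u in ra *; lia.
by exists b, a; split=> //; rewrite /b /u in ra *; lia.
Qed.

Lemma semigroup_split t m : 2 * g + 1 <= m -> t <= 2 * g + m -> H t ->
  exists a b, [/\ H a, H b, t = a + b, a <= 2 * g & b <= m].
Proof.
move=> le_m le_t Ht; have [le_tm|lt_tm] := leqP t m.
  by exists 0, t.
have [le_t4|lt_t4] := leqP t (4 * g + 1).
  have [||a [b [Ha inH tE lea leb]]] := @semigroup_split_small t; [lia..|].
  by exists a, b; split=> //; lia.
exists (2 * g), (t - 2 * g).
by split; [apply: semigroup_conductor|apply: semigroup_conductor|..]; lia.
Qed.

End NumericalSemigroup.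

Local Open Scope classical_set_scope.
Local Open Scope ring_scope.

(** * Linear algebra over K inside the function field *)

Section LinearCombinations.

Variables (K : finFieldType) (F : fieldType) (iota : {rmorphism K -> F}).

Definition linear_subspace (V : set F) : Prop :=
  V 0 /\ forall c f g, V f -> V g -> V (f + iota c * g).

Definition lincomb (d : nat) (e : 'I_d -> F) (c : 'rV[K]_d) : F :=
  \sum_i iota (c 0 i) * e i.

Lemma lincomb_closed (V : set F) d (e : 'I_d -> F) (c : 'rV[K]_d) :
  linear_subspace V -> (forall i, V (e i)) -> V (lincomb e c).
Proof.
move=> [V0 VD] Ve; rewrite /lincomb.
apply: big_rec => [//|i x _ Vx].
by rewrite addrC; apply: VD.
Qed.

Lemma lincombZD d (e : 'I_d -> F) (c : K) (a b : 'rV[K]_d) :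
  lincomb e a + iota c * lincomb e b = lincomb e (a + c *: b).
Proof.
rewrite /lincomb mulr_sumr -big_split /=; apply: eq_bigr => i _.
by rewrite !mxE rmorphD rmorphM mulrDl mulrA.
Qed.

(** A positive value is not the default 0 of [quo_dim], so it comes from an actual basis. *)
Lemma quo_dim_basis (V : set F) : (0 < quo_dim iota V [set 0%R])%N ->
  exists e : 'I_(quo_dim iota V [set 0%R]) -> F, (forall i, V (e i)) /\
    forall z, V z -> exists! c, z = lincomb e c.
Proof.
rewrite /quo_dim; case: xgetP => // d _ [e [Ve eP]] _; exists e; split=> // z.
move=> /eP [c [/eqP cP cuniq]]; exists c; split.
  by apply/eqP; rewrite -subr_eq0.
by move=> c' zE; apply: cuniq; rewrite /= zE subrr.
Qed.

(* By counting, as [K] is finite: [K^d] embeds in [K^m]. *)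
Lemma leq_dim_embed d m (V : set F) (e : 'I_d -> F) (w : 'I_m -> F) (h : F) :
  h != 0 -> linear_subspace V -> (forall i, V (e i)) ->
  (forall z, V z -> exists! c, z = lincomb e c) ->
  (forall z, V z -> exists a, z * h = lincomb w a) -> (d <= m)%N.
Proof.
move=> h0 Vcl Ve eP Vw.
have /choice [phi phiE] : forall c, exists a,
    lincomb e c * h = lincomb w a.
  by move=> c; apply: Vw; apply: lincomb_closed.
have phi_inj : injective phi.
  move=> c c' eq_phi; have := phiE c'; rewrite -eq_phi -phiE => /mulIf eq_e.
  have [a [_ au]] := eP _ (lincomb_closed c Vcl Ve).
  by rewrite -(au c)// -(au c')// eq_e.
have := leq_card phi phi_inj; rewrite !card_mx !mul1n leq_exp2l//.
exact: card_finNzRing_gt1.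
Qed.

End LinearCombinations.

(** * Valuations, residues and evaluation at rational points *)

Section Points.

Variables (K : finFieldType) (F : fieldType) (iota : {rmorphism K -> F}).
Implicit Types (P Q : closed_point iota) (f g h : F) (c : K) (m k : int).

Lemma val_at1 P : P 1 = 0.
Proof. by rewrite -(rmorph1 iota) val_at_const ?oner_neq0. Qed.

Lemma val_atZ P c f : c != 0 -> P (iota c * f) = P f.
Proof.
move=> c0; have [->|f0] := eqVneq f 0; first by rewrite mulr0.
by rewrite val_atM// ?fmorph_eq0// val_at_const// add0r.
Qed.

Lemma val_atV P f : P f^-1 = - P f.
Proof.
have [->|f0] := eqVneq f 0; first by rewrite invr0 val_at0 oppr0.
by apply/eqP; rewrite -addr_eq0 -val_atM ?invr_eq0// mulVf// val_at1.
Qed.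

Lemma val_atX P f (i : nat) : P (f ^+ i) = P f *+ i.
Proof.
have [->|f0] := eqVneq f 0.
  by rewrite expr0n; case: i => [|i]; rewrite /= ?val_at1 ?val_at0 ?mul0rn.
elim: i => [|i IHi]; first by rewrite val_at1.
by rewrite exprS val_atM ?expf_neq0// IHi mulrS.
Qed.

(** Zero is listed apart because [val_at] takes the value 0, not infinity, there. *)
Definition vge P m : set F := [set f | f = 0 \/ m <= P f].

Lemma vge_le P m k f : k <= m -> vge P m f -> vge P k f.
Proof. by move=> lekm [->|le]; [left | right; apply: le_trans le]. Qed.

Lemma vgeZ P m c f : vge P m f -> vge P m (iota c * f).
Proof.
have [->|c0] := eqVneq c 0; first by rewrite rmorph0 mul0r => _; left.
by case=> [->|le]; [rewrite mulr0; left | right; rewrite val_atZ].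
Qed.

Lemma vgeD P m f g : vge P m f -> vge P m g -> vge P m (f + g).
Proof.
move=> [->|lef]; first by rewrite add0r.
move=> [->|leg]; first by rewrite addr0; right.
have [->|fg0] := eqVneq (f + g) 0; first by left.
have [f0|f0] := eqVneq f 0; first by right; rewrite f0 add0r.
have [g0|g0] := eqVneq g 0; first by right; rewrite g0 addr0.
by right; apply: (le_trans _ (val_atD P f0 g0 fg0)); rewrite le_min lef.
Qed.

Lemma vgeN P m f : vge P m f -> vge P m (- f).
Proof. by move/(vgeZ (-1)); rewrite rmorphN1 mulN1r. Qed.

Lemma vgeB P m f g : vge P m f -> vge P m g -> vge P m (f - g).
Proof. by move=> vf /vgeN; apply: vgeD. Qed.

Lemma vgeM P m k f g : vge P m f -> vge P k g -> vge P (m + k) (f * g).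
Proof.
have [->|f0] := eqVneq f 0; first by rewrite mul0r => *; left.
have [->|g0] := eqVneq g 0; first by rewrite mulr0 => *; left.
move=> [/eqP|le1]; first by rewrite (negPf f0).
move=> [/eqP|le2]; first by rewrite (negPf g0).
by right; rewrite val_atM// lerD.
Qed.

Lemma vge_const P c : vge P 0 (iota c).
Proof.
have [->|c0] := eqVneq c 0; first by rewrite rmorph0; left.
by right; rewrite val_at_const.
Qed.

Lemma max_idealE P f : max_ideal P f <-> vge P 1 f.
Proof. by split=> -[|]; [left | right | left | right]. Qed.

Lemma vge1_const P c : vge P 1 (iota c) -> c = 0.
Proof.
case=> [/eqP|]; first by rewrite fmorph_eq0 => /eqP.
by have [//|c0] := eqVneq c 0; rewrite val_at_const.
Qed.

Lemma residue_uniq P f c c' :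
  vge P 1 (f - iota c) -> vge P 1 (f - iota c') -> c = c'.
Proof.
move=> vc /vgeB/(_ vc); rewrite opprB addrC addrA subrK -rmorphB.
by move=> /vge1_const/eqP; rewrite subr_eq0 => /eqP.
Qed.

(** The residue field is a line spanned by the class of some [e0], which may differ from 1. If f and
    1 are congruent to multiples a and b of [e0], the residue of f is a / b. *)
Lemma residueP P f : rational P -> vge P 0 f -> exists c, vge P 1 (f - iota c).
Proof.
rewrite /rational /degp /quo_dim; case: xgetP => // d -> [e [_ eP]] d1.
rewrite {d}d1 in e eP *.
have [|b [/max_idealE bP _]] := eP 1; first by right; rewrite val_at1.
rewrite big_ord1 in bP; set e0 := e ord0 in bP.
have b0 : b 0 ord0 != 0.
  apply: contraPneq bP => ->; rewrite rmorph0 mul0r subr0 => -[/eqP|].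
    by rewrite oner_eq0.
  by rewrite val_at1.
move=> /eP [a [/max_idealE aP _]]; rewrite big_ord1 -/e0 in aP.
exists (a 0 ord0 / b 0 ord0).
have := vgeB aP (vgeZ (a 0 ord0 / b 0 ord0) bP).
congr (vge P 1 _); rewrite mulrBr mulr1 mulrA -rmorphM divfK//.
by rewrite opprB addrA subrK.
Qed.

Lemma eval_at_eq P f c : vge P 1 (f - iota c) -> eval_at P f = c.
Proof.
move=> fc; apply: xget_unique => [|c' /max_idealE fc']; first exact/max_idealE.
exact: residue_uniq fc' fc.
Qed.

Lemma eval_atP P f : rational P -> vge P 0 f ->
  vge P 1 (f - iota (eval_at P f)).
Proof.
by move=> rP vf; have [c cP] := residueP rP vf; rewrite (eval_at_eq cP).
Qed.

Lemma eval_at_const P c : eval_at P (iota c) = c.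
Proof. by apply: eval_at_eq; rewrite subrr; left. Qed.

Lemma eval_atZD P c f g : rational P -> vge P 0 f -> vge P 0 g ->
  eval_at P (f + iota c * g) = eval_at P f + c * eval_at P g.
Proof.
move=> rP vf vg; apply: eval_at_eq.
have := vgeD (eval_atP rP vf) (vgeZ c (eval_atP rP vg)).
by congr (vge P 1 _); rewrite rmorphD rmorphM mulrBr opprD addrACA.
Qed.

Lemma eval_atM P f g : rational P -> vge P 0 f -> vge P 0 g ->
  eval_at P (f * g) = eval_at P f * eval_at P g.
Proof.
move=> rP vf vg; apply: eval_at_eq; rewrite rmorphM.
have := vgeM vf (eval_atP rP vg).
move=> /vgeD /(_ (vgeZ (eval_at P g) (eval_atP rP vf))); congr (vge P 1 _).
rewrite !mulrBr [in X in _ + X = _]mulrC addrA subrK; congr (_ - _).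
exact: mulrC.
Qed.

Lemma leading_residue Q f g : rational Q -> f != 0 -> g != 0 -> Q f = Q g ->
  exists2 c, c != 0 & vge Q (Q g + 1) (f - iota c * g).
Proof.
move=> rQ f0 g0 eqfg.
have [|c cP] := residueP (f := f / g) rQ.
  by right; rewrite val_atM ?invr_eq0// val_atV eqfg subrr.
exists c.
  apply: contraPneq cP => ->; rewrite rmorph0 subr0 => -[/eqP|].
    by rewrite mulf_eq0 invr_eq0 (negPf f0) (negPf g0).
  by rewrite val_atM ?invr_eq0// val_atV eqfg subrr.
have := vgeM (or_intror (lexx _) : vge Q (Q g) g) cP; congr (vge Q _ _).
by rewrite mulrBr mulrCA divff// mulr1 mulrC.
Qed.

Lemma RRspaceP (E : divisor iota) f :
  RRspace E f <-> forall P, vge P (- E P) f.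
Proof.
split=> [[-> P|le P]|vf]; [by left|by right; apply: le|].
have [->|f0] := eqVneq f 0; [by left|right=> P].
by case: (vf P) => // /eqP; rewrite (negPf f0).
Qed.

Lemma RRspace_closed (E : divisor iota) : linear_subspace iota (RRspace E).
Proof.
split; first by left.
move=> c f g /RRspaceP vf /RRspaceP vg; apply/RRspaceP => P.
exact/vgeD/vgeZ.
Qed.

End Points.

(** * Zeros and poles, from Riemann's inequality *)

Section OnePoint.

Variables (K : finFieldType) (F : fieldType) (iota : {rmorphism K -> F}).
Variables (g n : nat) (Q : closed_point iota) (P : 'I_n -> closed_point iota).
Hypothesis genus_g : genus iota g.
Hypothesis ratQ : rational Q.
Hypothesis ratP : forall i, rational (P i).
Hypothesis injP : injective P.
Hypothesis PQ : forall i, P i <> Q.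

Implicit Types (f h : F) (c : K) (m : int) (j k : nat).

Local Notation L m := (RRspace (mulpt m Q)).

Lemma LP m f : L m f <-> vge Q (- m) f /\ forall R, R <> Q -> vge R 0 f.
Proof.
rewrite RRspaceP; split=> [vf|[vQ vR] R].
  split=> [|R /eqP/negPf neRQ].
    by have := vf Q; rewrite /mulpt fsfunE inE eqxx.
  by have := vf R; rewrite /mulpt fsfunE inE neRQ oppr0.
rewrite /mulpt fsfunE inE; case: eqVneq => [->//|/eqP neRQ].
by rewrite oppr0; apply: vR.
Qed.

Let points := Q :: [seq P i | i <- enum 'I_n].

Let uniq_points : uniq points.
Proof.
rewrite /= map_inj_uniq// enum_uniq andbT.
by apply/mapP => -[i _ /esym]; apply: PQ.
Qed.

(* aQ + bD *)
Let two_level (a b : int) : divisor iota :=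
  [fsfun R in [fset R in points]%fset => if R == Q then a else b | 0].

Let two_levelE a b R :
  two_level a b R = if R \in points then if R == Q then a else b else 0.
Proof. by rewrite /two_level fsfunE /= !inE. Qed.

Let deg_two_level a b : deg (two_level a b) = a + b * n%:Z.
Proof.
rewrite /deg; set T := two_level a b.
have -> : \sum_(R <- finsupp T) T R * (degp R)%:Z =
          \sum_(R <- points) T R * (degp R)%:Z.
  (* [points] may contain points of coefficient 0, which [finsupp] omits. *)
  rewrite [RHS](bigID (mem (finsupp T)))/= [X in _ + X]big1 ?addr0.
    rewrite -[RHS]big_filter; apply: perm_big; apply: uniq_perm => //.
      exact: fset_uniq.
      exact: (filter_uniq _ uniq_points).
    move=> R; rewrite mem_filter; case: (boolP (R \in finsupp T)) => //=.
    by rewrite mem_finsupp two_levelE; case: (R \in points); rewrite ?eqxx.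
  by move=> R /fsfun_dflt ->; rewrite mul0r.
rewrite big_cons big_map two_levelE mem_head eqxx ratQ mulr1; congr (_ + _).
rewrite big_enum /= (eq_bigr (fun=> b)) => [|i _].
  by rewrite sumr_const card_ord -mulr_natr natz.
rewrite two_levelE ratP mulr1 inE map_f ?mem_enum// orbT.
by case: eqP => [/PQ|].
Qed.

(** Riemann's inequality. The bound on the degree makes [ell E] positive, so that it is the size of
    an actual basis. *)
Let genus_basis (E : divisor iota) : g%:Z <= deg E ->
  exists d (e : 'I_d -> F), [/\ deg E + 1 <= g%:Z + d%:Z,
    forall i, RRspace E (e i) &
    forall z, RRspace E z -> exists! a, z = lincomb iota e a].
Proof.
move=> degE; have := genus_g.1 E; rewrite /ell.
have := @quo_dim_basis K F iota (RRspace E).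
case: (quo_dim _ _ _) => [_|d /(_ isT) [e [eE eP]] degE']; first by lia.
by exists d.+1, e; split=> //; lia.
Qed.

(* If [f] had more zeros than poles, the powers of [f] would embed spaces of  *)
(* unbounded dimension in [L(gQ)].                                            *)
Lemma zeros_le_poles f m (s : nat) : f != 0 -> vge Q (- m) f ->
  (forall i, vge (P i) s%:Z f) -> (forall R, R <> Q -> vge R 0 f) ->
  (s * n)%:Z <= m.
Proof.
move=> f0 vQ vP vR; rewrite leNgt; apply/negP => lt_m.
have [|d0 [w [_ _ wP]]] := @genus_basis (two_level g%:Z 0).
  by rewrite deg_two_level mul0r addr0.
(* The divisor (g - d0 m) Q + d0 s D has degree g + d0 (s n - m) >= g + d0, so its space has
   dimension greater than d0; yet multiplication by [f ^+ d0] embeds it in L(gQ), of dimension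
   d0. *)
have deg_ge : g%:Z + d0%:Z <=
    deg (two_level (g%:Z - d0%:Z * m) (d0%:Z * s%:Z)).
  rewrite deg_two_level -mulrA -addrA lerD2l addrC -mulrBr -PoszM.
  by rewrite ler_peMr//; lia.
have [|d [e [d_ge eE eP]]] :=
  @genus_basis (two_level (g%:Z - d0%:Z * m) (d0%:Z * s%:Z)); first lia.
suff : (d <= d0)%N by lia.
apply: (leq_dim_embed (w := w) (h := f ^+ d0) _ (RRspace_closed _) eE eP).
  by rewrite expf_neq0.
move=> z /RRspaceP zE.
have [a [aE _]] : exists! a, z * f ^+ d0 = lincomb iota w a.
  apply: wP; apply/RRspaceP => R.
  have vX (e0 : int) : vge R e0 f -> vge R (d0%:Z * e0) (f ^+ d0).
    case=> [/eqP|le]; first by rewrite (negPf f0).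
    by right; rewrite val_atX -mulr_natl natz ler_wpM2l.
  have := zE R; rewrite !two_levelE; case: ifP => [Rpt|/negP Rpt] vz.
    case: eqVneq vz Rpt => [RQ vz _|neRQ vz].
      rewrite -RQ in vQ; apply: vge_le (vgeM vz (vX _ vQ)).
      by lia.
    rewrite inE (negPf neRQ) => /mapP[i _ RE].
    have vRs : vge R s%:Z f by rewrite RE; apply: vP.
    by move: (vgeM vz (vX _ vRs)); rewrite oppr0 addNr.
  have vR0 : vge R 0 f by apply: vR => RQ; apply: Rpt; rewrite RQ mem_head.
  by move: (vgeM vz (vX _ vR0)); rewrite oppr0 mulr0 addr0.
by exists a.
Qed.

(** * The spaces L(mQ) and the semigroup H *)

Lemma RRinfP f : RRinf Q f <-> forall R, R <> Q -> vge R 0 f.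
Proof.
split=> [[r _ /LP[]]//|vR]; exists `|Q f|%N => //; apply/LP; split=> //.
by right; lia.
Qed.

Lemma L_RRinf m f : L m f -> RRinf Q f.
Proof. by move=> /LP[_ vR]; apply/RRinfP. Qed.

Lemma L_closed m : linear_subspace iota (L m).
Proof. exact: RRspace_closed. Qed.

Lemma L_le m m' f : m <= m' -> L m f -> L m' f.
Proof.
by move=> le_m /LP[vQ vR]; apply/LP; split=> //; apply: vge_le vQ;
   rewrite lerN2.
Qed.

Lemma LM m m' f h : L m f -> L m' h -> L (m + m') (f * h).
Proof.
move=> /LP[vQ vR] /LP[vQ' vR']; apply/LP; rewrite opprD; split.
  exact: vgeM.
by move=> R neRQ; rewrite -[0]addr0; apply: vgeM; [apply: vR|apply: vR'].
Qed.

(** This is [zeros_le_poles] with [s = 0]; [L_zeros] is the case [s = 1]. *)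
Lemma L_neg f : L (- 1) f -> f = 0.
Proof.
move=> /LP[vQ vR]; apply: contrapT => /eqP f0.
by have := @zeros_le_poles f (-1) 0 f0 vQ (fun i => vR _ (@PQ i)) vR.
Qed.

Lemma L_zeros m f : m < n%:Z -> L m f -> (forall i, eval_at (P i) f = 0) ->
  f = 0.
Proof.
move=> lt_mn /LP[vQ vR] f0; apply: contrapT => /eqP nz_f.
have vP i : vge (P i) 1%:Z f.
  have := eval_atP (ratP i) (vR _ (@PQ i)).
  by rewrite f0 rmorph0 subr0.
by have := zeros_le_poles nz_f vQ vP vR; rewrite mul1n leNgt lt_mn.
Qed.

Lemma pole_L f k : RRinf Q f -> pole_order Q f k -> L k%:Z f.
Proof.
move=> /RRinfP vR [f0 fk]; apply/LP; split=> //; right.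
by rewrite -fk opprK.
Qed.

Lemma pole_nL f k : pole_order Q f k -> ~ L (k%:Z - 1) f.
Proof.
by move=> [f0 fk] /LP[[/eqP|]]; [rewrite (negPf f0)|lia].
Qed.

Lemma L_pole f k : L k%:Z f -> ~ L (k%:Z - 1) f -> pole_order Q f k.
Proof.
move=> /LP[vQ vR] nL; have f0 : f != 0.
  by apply/eqP => f0; apply: nL; rewrite f0; apply: (L_closed _).1.
split=> //; case: vQ => [/eqP|vQ]; first by rewrite (negPf f0).
apply/eqP; apply: contrapT => /eqP ne; apply: nL; apply/LP; split=> //.
by right; lia.
Qed.

Lemma poleM f h j k : pole_order Q f j -> pole_order Q h k ->
  pole_order Q (f * h) (j + k)%N.
Proof.
move=> [f0 fj] [h0 hk]; split; first by rewrite mulf_neq0.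
by rewrite val_atM// opprD fj hk.
Qed.

Lemma RRinfM f h : RRinf Q f -> RRinf Q h -> RRinf Q (f * h).
Proof. by move=> [r _ fr] [s _ hs]; exact: L_RRinf (LM fr hs). Qed.

Lemma pole1 : pole_order Q 1 0.
Proof. by split; rewrite ?oner_neq0// val_at1. Qed.

Lemma RRinf1 : RRinf Q 1.
Proof. by apply/RRinfP => R _; rewrite -(rmorph1 iota); apply: vge_const. Qed.

Lemma semigroupH0 : semigroupH Q 0.
Proof. by exists 1; [exact: RRinf1 | exact: pole1]. Qed.

Lemma semigroupHD j k : semigroupH Q j -> semigroupH Q k ->
  semigroupH Q (j + k)%N.
Proof.
move=> [f Rf fj] [h Rh hk].
by exists (f * h); [apply: RRinfM | apply: poleM].
Qed.

(** As Q is rational, leading coefficients at Q lie in K, and a multiple of h cancels the leading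
    term of f. *)
Lemma L_reduce f h k : RRinf Q h -> pole_order Q h k -> L k%:Z f ->
  exists c, L (k%:Z - 1) (f - iota c * h).
Proof.
move=> Rh hk Lf; have [Lf1|nLf] := pselect (L (k%:Z - 1) f).
  by exists 0; rewrite rmorph0 mul0r subr0.
have [f0 fk] := L_pole Lf nLf; have [h0 hk'] := hk.
have [|c _ vQ] := leading_residue ratQ f0 h0; first by lia.
exists c; apply/LP; split; first by apply: vge_le vQ; lia.
move=> R neRQ; move: (Lf) => /LP[_ /(_ R neRQ)] vf.
exact: vgeB vf (vgeZ c ((RRinfP h).1 Rh R neRQ)).
Qed.

Lemma L_gap k f : ~ semigroupH Q k -> L k%:Z f -> L (k%:Z - 1) f.
Proof.
move=> nH Lf; apply: contrapT => /(L_pole Lf) fk; apply: nH.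
by exists f => //; apply: L_RRinf Lf.
Qed.

(** Leading terms are cancelled one after the other, down to L(-Q) = 0. *)
Lemma L_ind (S : set F) k : linear_subspace iota S ->
  (forall j, (j < k)%N -> semigroupH Q j ->
     exists h, [/\ S h, RRinf Q h & pole_order Q h j]) ->
  forall f, L (k%:Z - 1) f -> S f.
Proof.
move=> [S0 SD]; elim: k => [|k IHk] Sh f.
  by rewrite sub0r => /L_neg ->.
have -> : k.+1%:Z - 1 = k%:Z by lia.
move=> Lf.
have {}IHk : forall h, L (k%:Z - 1) h -> S h.
  by apply: IHk => j lt_jk; apply: Sh; apply: ltnW.
have [Hk|nHk] := pselect (semigroupH Q k); last exact/IHk/L_gap.
have [h [Sh' Rh hk]] := Sh k (leqnn _) Hk.
have [c /IHk Sfh] := L_reduce Rh hk Lf.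
by rewrite -(subrK (iota c * h) f); apply: SD.
Qed.

Definition inH : pred nat := [pred k | `[< semigroupH Q k >]].

Lemma inH0 : inH 0. Proof. exact/asboolP/semigroupH0. Qed.

Lemma inHD j k : inH j -> inH k -> inH (j + k)%N.
Proof. by move=> /asboolP Hj /asboolP Hk; apply/asboolP/semigroupHD. Qed.

(** L((l - 1)Q) is spanned by one function for each element of H below l, while Riemann's inequality
    gives it dimension at least l - g. The choice of l makes the degree l - 1 at least g. *)
Lemma gaps_le_genus k : (gaps inH 0 k <= g)%N.
Proof.
pose l := (k + g + 1)%N.
have [|d [e [d_ge eE eP]]] := @genus_basis (two_level (l%:Z - 1) 0).
  by rewrite deg_two_level mul0r addr0; lia.
rewrite deg_two_level mul0r addr0 subrK in d_ge.
pose s := [seq j <- index_iota 0 l | inH j].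
have /choice[phi phiP] : forall j, exists h, inH j ->
    RRinf Q h /\ pole_order Q h j.
  move=> j; case: (boolP (inH j)) => [/asboolP[h Rh hj]|_]; last by exists 0.
  by exists h.
have size_s : (size s + gaps inH 0 l = l)%N.
  by rewrite size_filter count_gaps.
have le_ds : (d <= size s)%N.
  apply: (leq_dim_embed (w := fun i : 'I_(size s) => phi (nth 0%N s i))
     (oner_neq0 _) (RRspace_closed _) eE eP) => z Lz; rewrite mulr1.
  apply: (@L_ind [set f | exists a, f = lincomb iota _ a] l) => [|j lt_jl Hj|].
  - split.
      by exists 0; rewrite /lincomb big1// => i _; rewrite mxE rmorph0 mul0r.
    by move=> c _ _ [a ->] [b ->]; exists (a + c *: b); rewrite lincombZD.
  - have Hbj : inH j by apply/asboolP.
    have js : j \in s by rewrite mem_filter Hbj mem_index_iota.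
    have [Rj pj] := phiP j Hbj; exists (phi j); split=> //.
    pose i := Ordinal (etrans (index_mem j s) js).
    exists (delta_mx 0 i); rewrite /lincomb (bigD1 i)//= big1 => [|i' nei].
      by rewrite mxE !eqxx rmorph1 mul1r addr0 nth_index.
    by rewrite mxE (negPf nei) andbF rmorph0 mul0r.
  - apply/LP; move/RRspaceP: Lz => vz; split=> [|R neRQ].
      by have := vz Q; rewrite two_levelE mem_head eqxx.
    have := vz R; rewrite two_levelE; case: ifP; rewrite ?oppr0//.
    by case: eqP.
have le_kl : (k <= l)%N by rewrite /l -addnA leq_addr.
have := gaps_cat inH (leq0n k) le_kl; move: (gaps _ k l) (gaps _ 0 k) size_s.
by move=> x y + xE; rewrite xE; lia.
Qed.

(** * The codes C(D, mQ), their dimensions, and H^* *)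

Local Notation code := (code P Q).
Local Notation Hstar := (Hstar P Q).

Lemma evZD c f h : RRinf Q f -> RRinf Q h ->
  ev P (f + iota c * h) = ev P f + c *: ev P h.
Proof.
move=> /RRinfP Rf /RRinfP Rh; apply/rowP => i; rewrite !mxE.
by rewrite eval_atZD//; [apply: Rf | apply: Rh].
Qed.

Lemma ev0 : ev P 0 = 0.
Proof. by apply/rowP => i; rewrite !mxE -(rmorph0 iota) eval_at_const. Qed.

Lemma code_ev m f : L m f -> code m (ev P f).
Proof. by move=> Lf; exists f. Qed.

Lemma code0 m : code m 0.
Proof. by rewrite -ev0; apply/code_ev/(L_closed m).1. Qed.

Lemma codeZD m c u v : code m u -> code m v -> code m (u + c *: v).
Proof.
move=> [f Lf <-] [h Lh <-]; rewrite -(evZD c (L_RRinf Lf) (L_RRinf Lh)).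
by apply: code_ev; apply: (L_closed m).2.
Qed.

Lemma code_le m m' : m <= m' -> code m `<=` code m'.
Proof. by move=> le_m _ [f Lf <-]; apply/code_ev/(L_le le_m). Qed.

Lemma code_neg u : code (- 1) u -> u = 0.
Proof. by move=> [f /L_neg -> <-]; exact: ev0. Qed.

Lemma hstar_semigroup k : Hstar k -> semigroupH Q k.
Proof.
move=> Hk; apply: contrapT => nHk; apply: Hk; apply/seteqP; split.
  by move=> _ [f Lf <-]; apply/code_ev/L_gap.
by apply: code_le; lia.
Qed.

(** Otherwise [L_reduce] would put all of C(D, kQ) inside C(D, (k-1)Q). *)
Lemma hstar_pole k f : Hstar k -> RRinf Q f -> pole_order Q f k ->
  ~ code (k%:Z - 1) (ev P f).
Proof.
move=> Hk Rf fk Cf; apply: Hk; apply/seteqP; split; last by apply: code_le; lia.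
move=> _ [h Lh <-]; have [c Lhf] := L_reduce Rf fk Lh.
rewrite -(subrK (iota c * f) h) evZD//; last exact: L_RRinf Lhf.
exact: codeZD (code_ev Lhf) Cf.
Qed.

Lemma hstar_code k f : L k%:Z f -> ~ code (k%:Z - 1) (ev P f) -> Hstar k.
Proof. by move=> Lf nC eqC; apply: nC; rewrite -eqC; apply: code_ev. Qed.

(** From a function of order k, subtract one of smaller order with the same evaluation. *)
Lemma not_hstar k : semigroupH Q k -> ~ Hstar k ->
  exists f, [/\ RRinf Q f, pole_order Q f k & ev P f = 0].
Proof.
move=> [f Rf fk] nHk; have Lf := pole_L Rf fk.
have : code (k%:Z - 1) (ev P f).
  by apply: contrapT => nC; apply: nHk; apply: hstar_code nC.
case=> h Lh evh; have Lfh : L k%:Z (f + iota (-1) * h).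
  by apply: (L_closed k%:Z).2 => //; apply: L_le Lh; lia.
exists (f + iota (-1) * h); split; first exact: L_RRinf Lfh.
  apply: L_pole => // Lfh1; apply: (pole_nL fk).
  have -> : f = f + iota (-1) * h + iota 1 * h.
    by rewrite rmorphN1 mulN1r rmorph1 mul1r subrK.
  exact: (L_closed _).2.
by rewrite (evZD _ Rf (L_RRinf Lh)) evh scaleN1r subrr.
Qed.

(** H \ H^* is an ideal of H: a multiple of a function vanishing at all the [P i] vanishes there
    too. *)
Lemma hstarM j k : semigroupH Q j -> semigroupH Q k -> Hstar (j + k)%N ->
  Hstar j.
Proof.
move=> Hj [h Rh hk] Hjk; apply: contrapT => /(not_hstar Hj)[f [Rf fj ev_f]].
apply: (hstar_pole Hjk (RRinfM Rf Rh) (poleM fj hk)).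
suff -> : ev P (f * h) = 0 by exact: code0.
apply/rowP => i; rewrite !mxE.
rewrite (eval_atM (ratP i) ((RRinfP f).1 Rf _ (@PQ i))
  ((RRinfP h).1 Rh _ (@PQ i))).
have := congr1 (fun u : 'rV_n => u 0 i) ev_f; rewrite !mxE => ->.
by rewrite mul0r.
Qed.

Lemma hstar_small k : (k < n)%N -> semigroupH Q k -> Hstar k.
Proof.
move=> lt_kn Hk; apply: contrapT => /(not_hstar Hk)[f [Rf fk ev_f]].
have [/eqP + _] := fk; apply.
apply: (L_zeros (m := k)) => //; first exact: pole_L.
move=> i; have := congr1 (fun u : 'rV_n => u 0 i) ev_f.
by rewrite !mxE.
Qed.

(** The code as a [vspace], to have dimensions; spanning the list of all its vectors adds nothing
    ([codevP]). *)
Definition codev m : {vspace 'rV[K]_n} :=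
  <<[seq u : 'rV[K]_n <- enum predT | `[< code m u >]]>>%VS.

Lemma span_ind (S : set 'rV[K]_n) (X : seq 'rV[K]_n) :
  S 0 -> (forall c u v, S u -> S v -> S (u + c *: v)) ->
  (forall u, u \in X -> S u) -> forall u, u \in <<X>>%VS -> S u.
Proof.
move=> S0 SZD SX u /(coord_span (X := in_tuple X)) ->.
apply: big_rec => // i v _ Sv; rewrite addrC; apply: SZD => //.
by apply: SX; apply: mem_nth.
Qed.

Lemma codevP m u : u \in codev m <-> code m u.
Proof.
split=> [|Cu]; last first.
  by apply: memv_span; rewrite mem_filter mem_enum andbT; apply/asboolP.
apply: (span_ind (code0 m) (@codeZD m)) => {}u.
by rewrite mem_filter => /andP[/asboolP].
Qed.

Lemma codev_le m m' : m <= m' -> (codev m <= codev m')%VS.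
Proof. by move=> /code_le le; apply/subvP => u /codevP/le/codevP. Qed.

(** The codes form a chain, so dimensions decide inclusion. *)
Lemma code_dim_sub m m' : (\dim (codev m) <= \dim (codev m'))%N ->
  code m `<=` code m'.
Proof.
move=> le_dim; have [/code_le//|/ltW le_m] := leP m m'.
suff /eqP eq_cv : codev m' == codev m.
  by move=> u /codevP; rewrite -eq_cv => /codevP.
by rewrite -(geq_leqif (dimv_leqif_eq (codev_le le_m))).
Qed.

Definition inHstar : pred nat := [pred k | `[< Hstar k >]].

(** The rank in H^*: it inverts [mstar], indexed from 0 ([cnt_hstar], [cnt_mstar]), and is the
    dimension of C(D, (k-1)Q) ([dim_codev]). *)
Definition cnt k : nat := count inHstar (index_iota 0 k).

Lemma cntS k : cnt k.+1 = (cnt k + inHstar k)%N.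
Proof. by rewrite /cnt /index_iota !subn0 -addn1 iotaD count_cat /= addn0. Qed.

Lemma cntS_hstar k : Hstar k -> cnt k.+1 = (cnt k).+1.
Proof. by move=> /asboolP Hk; rewrite cntS [inHstar k]Hk addn1. Qed.

Lemma dim_codev k : \dim (codev (k%:Z - 1)) = cnt k.
Proof.
elim: k => [|k IHk].
  apply/eqP; rewrite dimv_eq0 -subv0; apply/subvP => u /codevP.
  by rewrite sub0r => /code_neg ->; rewrite mem0v.
have -> : k.+1%:Z - 1 = k%:Z by lia.
rewrite cntS -IHk; have [/asboolP Hk|/asboolPn nHk] := boolP (inHstar k);
  last first.
  rewrite addn0; congr (\dim _); rewrite /codev.
  suff -> : code k%:Z = code (k%:Z - 1) by [].
  exact: contrapT.
have [f Rf fk] := hstar_semigroup Hk.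
have sub : (codev (k%:Z - 1) <= codev k%:Z)%VS by apply: codev_le; lia.
apply/eqP; rewrite eqn_leq addn1; apply/andP; split.
  have : (codev k%:Z <= codev (k%:Z - 1) + <[ev P f]>)%VS.
    apply/subvP => _ /codevP[h Lh <-]; have [c Lhf] := L_reduce Rf fk Lh.
    rewrite -(subrK (iota c * f) h) evZD//; last exact: L_RRinf Lhf.
    apply: memv_add; first exact/codevP/code_ev.
    by rewrite memvZ// memv_line.
  move=> /dimvS /leq_trans; apply; apply: leq_trans (dimv_add_leqif _ _) _.
  by rewrite -[leqRHS]addn1 leq_add2l dim_vline; case: (_ != _).
rewrite ltn_neqAle dimvS// andbT; apply/eqP => /eqP.
rewrite (dimv_leqif_eq sub) => /eqP eq_cv.
apply: (hstar_pole Hk Rf fk); apply/codevP; rewrite eq_cv; apply/codevP.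
exact/code_ev/pole_L.
Qed.

Lemma cnt_small k : (k <= n)%N -> (cnt k + gaps inH 0 k = k)%N.
Proof.
move=> le_kn; rewrite -[RHS](count_gaps inH); congr (_ + _)%N.
apply: eq_in_count => j; rewrite mem_index_iota => /andP[_ lt_jk].
apply/asboolP/asboolP; first exact: hstar_semigroup.
by apply: hstar_small; apply: leq_trans lt_jk le_kn.
Qed.

Lemma cnt_le j k : (j <= k)%N -> (cnt j <= cnt k)%N.
Proof.
move=> le_jk; rewrite /cnt /index_iota !subn0 -(subnKC le_jk) iotaD count_cat.
exact: leq_addr.
Qed.

(** * The bilinear form given by the isometry-dual condition *)

Section IsometryDual.

Hypothesis n_gt : (2 * g + 2 < n)%N.
Variable x : 'rV[K]_n.
Hypothesis x_neq0 : forall i, x 0 i != 0.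
Hypothesis x_dual : forall i, (i <= n)%N ->
  chi x @` code_seq P Q i = dual (code_seq P Q (n - i)).

Local Notation mstar := (mstar P Q).

Definition form (u v : 'rV[K]_n) : K := \sum_i x 0 i * u 0 i * v 0 i.

Lemma formZDl c u u' v : form (u + c *: u') v = form u v + c * form u' v.
Proof.
rewrite /form mulr_sumr -big_split; apply: eq_bigr => j _ /=.
by rewrite !mxE mulrDr mulrDl; congr (_ + _); rewrite mulrCA !mulrA.
Qed.

Lemma formC u v : form u v = form v u.
Proof. by apply: eq_bigr => j _; rewrite mulrAC. Qed.

Lemma formZDr c u v v' : form u (v + c *: v') = form u v + c * form u v'.
Proof. by rewrite formC formZDl !(formC u). Qed.

Lemma form0r u : form u 0 = 0.
Proof. by apply: big1 => j _; rewrite mxE mulr0. Qed.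

Lemma chi_inj : injective (chi x).
Proof.
move=> u v /rowP eq_uv; apply/rowP => j; have := eq_uv j; rewrite !mxE.
exact/mulfI.
Qed.

Lemma dual_chiP (C : set 'rV[K]_n) u :
  dual C (chi x u) <-> forall w, C w -> form u w = 0.
Proof.
suff formE w : form u w = \sum_i w 0 i * chi x u 0 i.
  by split=> Cu w /Cu; rewrite formE.
by apply: eq_bigr => j _; rewrite mxE mulrC.
Qed.

(* [code_seq P Q i] unfolds to [code (cs i)]. *)
Let cs i : int := if i is j.+1 then (mstar j)%:Z else - 1.

Let cs_gt0 i : (0 < i)%N -> cs i = (mstar i.-1)%:Z.
Proof. by case: i. Qed.

(** Transports the isometry-dual condition from [chi] and [dual] to [form]. *)
Let code_csP i u : (i <= n)%N ->
  code (cs i) u <-> forall w, code (cs (n - i)) w -> form u w = 0.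
Proof.
move=> le_in; have := x_dual le_in; rewrite /code_seq -/(cs i) -/(cs (n - i)).
move=> eqC; rewrite -dual_chiP -eqC; split=> [Cu|[v Cv /chi_inj <-]//].
by exists u.
Qed.

Definition topm := mstar n.-1.

Let n_gt0 : (0 < n)%N. Proof. exact: leq_ltn_trans n_gt. Qed.

(** The isometry-dual condition at i = n, where C_0 = 0. From it [Hstar] is seen to be finite, so
    that [mstar] does enumerate it. *)
Lemma code_top u : code topm%:Z u.
Proof.
rewrite -cs_gt0//; apply/code_csP => //; rewrite subnn => w /code_neg ->.
exact: form0r.
Qed.

Lemma hstar_le_top k : Hstar k -> (k <= topm)%N.
Proof.
move=> Hk; rewrite leqNgt; apply/negP => lt_k; apply: Hk.
apply/seteqP; split=> u _; apply: code_le (code_top u); lia.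
Qed.

Lemma cnt_top : cnt topm.+1 = n.
Proof.
rewrite -dim_codev; have -> : topm.+1%:Z - 1 = topm%:Z by lia.
suff -> : codev topm%:Z = fullv by rewrite dimvf /dim /= mul1n.
by apply/eqP; rewrite eqEsubv subvf; apply/subvP => u _; apply/codevP/code_top.
Qed.

Lemma hstar_finite : finite_set Hstar.
Proof.
apply: (sub_finite_set (B := `I_topm.+1)); last exact: finite_II.
by move=> k /hstar_le_top.
Qed.

Let hs := [seq k <- index_iota 0 topm.+1 | inHstar k].

Let mstarE i : mstar i = nth 0%N hs i.
Proof.
rewrite /Defs.mstar; congr nth; apply: (sorted_eq leq_trans anti_leq).
- by apply: sort_sorted; apply: leq_total.
- by apply: sorted_filter; [exact: leq_trans|exact: iota_sorted].
apply: uniq_perm; first by rewrite sort_uniq fset_uniq.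
  by rewrite filter_uniq// iota_uniq.
move=> k; rewrite mem_sort in_fset_set; last exact: hstar_finite.
rewrite mem_filter mem_index_iota; apply/idP/andP => [|[/asboolP Hk _]].
  by move/set_mem => Hk; split; [exact/asboolP|exact: hstar_le_top].
exact/mem_set.
Qed.

Let size_hs : size hs = n.
Proof. by rewrite size_filter -/(cnt _) cnt_top. Qed.

Lemma mstar_hstar i : (i < n)%N -> Hstar (mstar i).
Proof.
move=> lt_in; have : nth 0%N hs i \in hs by rewrite mem_nth ?size_hs.
by rewrite -mstarE mem_filter => /andP[/asboolP].
Qed.

Lemma cnt_hstar k : Hstar k -> mstar (cnt k) = k /\ (cnt k < n)%N.
Proof.
move=> Hk; have Hbk : inHstar k by apply/asboolP.
have le_kt := hstar_le_top Hk; split; last first.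
  rewrite -cnt_top; apply: leq_trans (cnt_le (_ : k.+1 <= _)%N) => //.
  by rewrite cntS Hbk addn1.
rewrite mstarE /hs /index_iota subn0 -(subnKC (leqW le_kt)) iotaD filter_cat.
rewrite nth_cat size_filter /cnt /index_iota subn0 ltnn subnn subSn//=.
by rewrite Hbk.
Qed.

Lemma cnt_mstar i : (i < n)%N -> cnt (mstar i) = i.
Proof.
move=> lt_in; have [+ lt_n] := cnt_hstar (mstar_hstar lt_in).
have uniq_hs : uniq hs by rewrite filter_uniq// iota_uniq.
rewrite [in LHS]mstarE [RHS]mstarE => /eqP.
by rewrite nth_uniq ?size_hs// => /eqP.
Qed.

Let dim_cs i : (i <= n)%N -> \dim (codev (cs i)) = i.
Proof.
case: i => [_|i lt_in] /=; first by rewrite -[- 1]add0r dim_codev.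
have -> : (mstar i)%:Z = (mstar i).+1%:Z - 1 by lia.
by rewrite dim_codev cntS_hstar ?cnt_mstar//; apply: mstar_hstar.
Qed.

Lemma dim_codev_le m : (\dim (codev m) <= n)%N.
Proof.
by apply: leq_trans (dimvS (subvf _)) _; rewrite dimvf /dim /= mul1n.
Qed.

(** Since dimensions decide inclusion, the orthogonality of C_i and C_(n-i) becomes a condition on
    dimensions alone; [code_form] is the converse for complementary dimensions. *)
Lemma code_form0 a b u w : (\dim (codev a) + \dim (codev b) <= n)%N ->
  code a u -> code b w -> form u w = 0.
Proof.
move=> le_n Ca Cb; have le_a := dim_codev_le a.
have /code_csP : code (cs (\dim (codev a))) u.
  by apply: code_dim_sub Ca; rewrite dim_cs.
apply=> //; apply: code_dim_sub Cb; rewrite dim_cs ?leq_subr//; lia.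
Qed.

Lemma code_form a b u : (\dim (codev a) + \dim (codev b))%N = n ->
  (forall w, code b w -> form u w = 0) -> code a u.
Proof.
move=> eq_n fu0; have le_a := dim_codev_le a.
apply: (@code_dim_sub (cs (\dim (codev a)))); first by rewrite dim_cs.
apply/code_csP => // w Cw; apply: fu0; apply: code_dim_sub Cw.
by rewrite dim_cs ?leq_subr//; lia.
Qed.

(* Working with [gam <= g] instead of [g] avoids having to show that the      *)
(* genus is attained at multiples of [Q].                                     *)
Let gam := gaps inH 0 (2 * g).

Let gaps_le_gam k : (gaps inH 0 k <= gam)%N.
Proof.
have [le_k|/ltnW le_k] := leqP (2 * g) k.
  by rewrite (gaps_stable inH0 inHD gaps_le_genus le_k).
by rewrite /gam (gaps_cat inH (leq0n k) le_k) leq_addr.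
Qed.

Let gam_le : (gam <= g)%N. Proof. exact: gaps_le_genus. Qed.

Let cnt_gam k : (2 * gam <= k)%N -> (k <= n)%N -> cnt k = (k - gam)%N.
Proof.
move=> le_k /cnt_small; rewrite (gaps_stable inH0 inHD gaps_le_gam le_k).
rewrite -(gaps_stable inH0 inHD gaps_le_gam (_ : _ <= 2 * g)%N) -/gam; lia.
Qed.

(** * The functional [phi] and the symmetry of H^* *)

Definition phi f : K := \sum_i x 0 i * eval_at (P i) f.

Lemma phiM f h : RRinf Q f -> RRinf Q h -> phi (f * h) = form (ev P f) (ev P h).
Proof.
move=> /RRinfP Rf /RRinfP Rh; apply: eq_bigr => i _.
by rewrite !mxE (eval_atM (ratP i) (Rf _ (@PQ i)) (Rh _ (@PQ i))) mulrA.
Qed.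

Lemma phi_closed : linear_subspace iota [set f | RRinf Q f /\ phi f = 0].
Proof.
split=> [|c f h [Rf f0] [Rh h0]] /=.
  split; first by exists 0%N => //; apply: (L_closed _).1.
  by apply: big1 => i _; rewrite -(rmorph0 iota) eval_at_const mulr0.
split.
  by apply/RRinfP => R neRQ; apply: vgeD; [|apply: vgeZ]; apply: (RRinfP _).1.
rewrite -[RHS](_ : phi f + c * phi h = 0); last by rewrite f0 h0 mulr0 addr0.
rewrite /phi mulr_sumr -big_split /=; apply: eq_bigr => i _.
have [Rfi Rhi] := ((RRinfP f).1 Rf _ (@PQ i), (RRinfP h).1 Rh _ (@PQ i)).
by rewrite (eval_atZD _ (ratP i) Rfi Rhi) mulrDr mulrCA.
Qed.

(** By [L_ind], products of a function of order at most 2 gam and one of order at most n - 2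
    suffice. Their evaluations lie in codes of dimensions gam + 1 and n - 1 - gam, with sum n, so
    they are orthogonal. *)
Lemma phi_eq0 f : L ((n + 2 * gam - 1)%N%:Z - 1) f -> phi f = 0.
Proof.
move=> Lf; apply: (proj2 (L_ind phi_closed _ Lf)) => j lt_j /asboolP Hj.
(* The bound n > 2g + 2 makes n - 2 >= 2 gam + 1, as [semigroup_split] requires. *)
have [|||a [b [/asboolP[f1 R1 p1] /asboolP[f2 R2 p2] -> le_a le_b]]] :=
  @semigroup_split _ inH0 inHD _ gaps_le_gam j (n - 2); [lia|lia|exact: Hj|].
exists (f1 * f2); split=> [||]; [|exact: RRinfM|exact: poleM].
split; first exact: RRinfM.
rewrite phiM//; apply: (@code_form0 (2 * gam)%N%:Z (n - 2)%N%:Z).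
- have -> : (2 * gam)%N%:Z = (2 * gam).+1%N%:Z - 1 by lia.
  have -> : (n - 2)%N%:Z = (n - 1)%N%:Z - 1 by lia.
  by rewrite !dim_codev !cnt_gam; lia.
- by apply/code_ev/(L_le _ (pole_L R1 p1)); lia.
- by apply/code_ev/(L_le _ (pole_L R2 p2)); lia.
Qed.

Lemma phi_neq0 : exists2 f, L topm%:Z f & phi f != 0.
Proof.
pose i0 := Ordinal n_gt0; have [f Lf ev_f] := code_top (delta_mx 0 i0).
exists f => //; rewrite /phi (bigD1 i0)//= big1 ?addr0 => [|i nei].
  have := congr1 (fun u : 'rV_n => u 0 i0) ev_f; rewrite !mxE !eqxx => ->.
  by rewrite mulr1.
have := congr1 (fun u : 'rV_n => u 0 i) ev_f; rewrite !mxE (negPf nei) andbF.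
by move=> ->; rewrite mulr0.
Qed.

Lemma top_ge : (n + 2 * gam - 1 <= topm)%N.
Proof.
rewrite leqNgt; apply/negP => lt_top; have [f Lf /eqP] := phi_neq0; apply.
by apply: phi_eq0; apply: L_le Lf; lia.
Qed.

Lemma hstar_top : Hstar topm.
Proof. by apply: mstar_hstar; rewrite prednK. Qed.

Lemma cnt_topm : cnt topm = n.-1.
Proof. by apply: cnt_mstar; rewrite prednK. Qed.

(** In f = 1 * f, the factor 1 evaluates in C(D, 0Q), of dimension at most 1, and f in C(D, (m_n -
    1)Q), of dimension n - 1. *)
Lemma phi_lt_top f : L (topm%:Z - 1) f -> phi f = 0.
Proof.
move=> Lf; rewrite -[f]mul1r phiM; [|exact: RRinf1|exact: L_RRinf Lf].
apply: (code_form0 (a := 1%:Z - 1)) (code_ev Lf).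
  by rewrite !dim_codev cntS cnt_topm; case: (inHstar 0); rewrite /cnt /=; lia.
by apply: code_ev; exact: pole_L RRinf1 pole1.
Qed.

Lemma phi_top f : RRinf Q f -> pole_order Q f topm -> phi f != 0.
Proof.
move=> Rf ft; apply/eqP => phif0; have [h Lh /eqP] := phi_neq0; apply.
have [c Lhf] := L_reduce Rf ft Lh; rewrite -(subrK (iota c * f) h).
apply: (phi_closed.2 c _ _ _ _).2 => //; split; first exact: L_RRinf Lhf.
exact: phi_lt_top.
Qed.

(** If j + k < m_n, a function of order j evaluates orthogonally to C(D, kQ), hence into C(D,
    (j-1)Q) by dimension, against j being in H^*. *)
Lemma hstar_add_ge j k : Hstar j -> Hstar k -> (cnt j + cnt k)%N = n.-1 ->
  (topm <= j + k)%N.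
Proof.
move=> Hj Hk cnt_jk; rewrite leqNgt; apply/negP => lt_top.
have [f Rf fj] := hstar_semigroup Hj; apply: (hstar_pole Hj Rf fj).
apply: (@code_form _ k%:Z) => [|_ [h Lh <-]].
  have -> : k%:Z = k.+1%:Z - 1 by lia.
  by rewrite !dim_codev (cntS_hstar Hk); lia.
rewrite -phiM//; last exact: L_RRinf Lh.
by apply: phi_lt_top; apply: L_le (LM (pole_L Rf fj) Lh); lia.
Qed.

Lemma cnt_add_top j k : Hstar j -> Hstar k -> (j + k)%N = topm ->
  (cnt j + cnt k)%N = n.-1.
Proof.
move=> Hj Hk jk_top.
have [[_ lt_j] [_ lt_k]] := (cnt_hstar Hj, cnt_hstar Hk).
have [lt_n|gt_n|//] := ltngtP (cnt j + cnt k) n.-1.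
  have [f Rf fj] := hstar_semigroup Hj; have [h Rh hk] := hstar_semigroup Hk.
  have := phi_top (RRinfM Rf Rh); rewrite -jk_top => /(_ (poleM fj hk)).
  rewrite phiM// (@code_form0 j%:Z k%:Z) ?eqxx//; try exact/code_ev/pole_L.
  have -> : j%:Z = j.+1%:Z - 1 by lia.
  have -> : k%:Z = k.+1%:Z - 1 by lia.
  by rewrite !dim_codev (cntS_hstar Hj) (cntS_hstar Hk); lia.
(* If the indices add up to too much, the element k' complementary to j in index is below k, so j +
   k' < m_n, against [hstar_add_ge]. *)
pose k' := mstar (n.-1 - cnt j); have lt_i : (n.-1 - cnt j < n)%N by lia.
have := hstar_add_ge Hj (mstar_hstar lt_i); rewrite cnt_mstar// -/k'.
have := cnt_mstar lt_i; rewrite -/k' => cnt_k' ge_top.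
have lt_kk' : (k' < k)%N.
  by rewrite ltnNge; apply/negP => /cnt_le; rewrite cnt_k'; lia.
by have := ge_top ltac:(lia); lia.
Qed.

(** Here m_n - k is beyond the conductor of H, and [hstarM] applies to its sum m_n with k. *)
Lemma hstar_compl k : Hstar k -> (k + 2 * gam <= topm)%N -> Hstar (topm - k)%N.
Proof.
move=> Hk le_k; have /asboolP Hc : inH (topm - k)%N.
  by apply: (semigroup_conductor inH0 inHD gaps_le_gam); lia.
apply: (hstarM Hc (hstar_semigroup Hk)).
have -> : (topm - k + k)%N = topm by lia.
exact: hstar_top.
Qed.

Lemma mstar_compl k : Hstar k -> (k + mstar (n.-1 - cnt k) = topm)%N.
Proof.
move=> Hk; have [mk lt_k] := cnt_hstar Hk; have top_ge := top_ge.
have lt_i : (n.-1 - cnt k < n)%N by lia.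
set l := mstar _; have Hl : Hstar l := mstar_hstar lt_i.
have cnt_l : cnt l = (n.-1 - cnt k)%N := cnt_mstar lt_i.
have [le_k|lt_top] := leqP (k + 2 * gam) topm.
  have Hc := hstar_compl Hk le_k.
  have cnt_c := cnt_add_top Hk Hc ltac:(lia).
  have <- : (topm - k)%N = l by rewrite -(cnt_hstar Hc).1 /l; congr mstar; lia.
  lia.
(* Now k > m_n - 2 gam >= n - 1, so its index is large and l is small. The previous argument applies
   to l instead: m_n - l has the index of k, hence equals k. *)
have cnt_k : (n - gam <= cnt k)%N by rewrite -cnt_gam; [apply: cnt_le|..]; lia.
have lt_ln : (l < n)%N.
  by rewrite ltnNge; apply/negP => /cnt_le; rewrite cnt_gam; lia.
have Hc := hstar_compl Hl ltac:(lia).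
have cnt_c := cnt_add_top Hl Hc ltac:(lia).
have : (topm - l)%N = k by rewrite -(cnt_hstar Hc).1 -[RHS]mk; congr mstar; lia.
lia.
Qed.

Lemma hstar_sym k : Hstar k -> Hstar (topm - k)%N.
Proof.
move=> Hk; have [_ lt_k] := cnt_hstar Hk; have <- := mstar_compl Hk.
by rewrite addKn; apply: mstar_hstar; lia.
Qed.

Lemma mstar_rev (i : 'I_n) : (mstar i + mstar (rev_ord i) = topm)%N.
Proof.
have <- := mstar_compl (mstar_hstar (ltn_ord i)); rewrite cnt_mstar//.
by congr (_ + mstar _)%N; rewrite /=; lia.
Qed.

(** Put r = m_n - m_i. If m = m_i + h is in H^*, then r - h = m_n - m is in H^* by symmetry.
    Conversely, if r = t + s, then t and s are in H^* by [hstarM], and m_i + t = m_n - s is in H^*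
    by symmetry. *)
Lemma card_Lambda_star (i : 'I_n) :
  #|` fset_set (Lambda_star P Q i)| =
  #|` fset_set (Aset Q (mstar (rev_ord i)))|.
Proof.
have sum_top := mstar_rev i; set r := mstar (rev_ord i) in sum_top *.
have Hr : Hstar r by apply: mstar_hstar.
have A_fin : finite_set (Aset Q r).
  apply: (sub_finite_set (B := `I_r.+1)); last exact: finite_II.
  by move=> t [_ [s _ ->]]; rewrite /= ltnS leq_addr.
suff -> : Lambda_star P Q i = addn (mstar i) @` Aset Q r.
  by rewrite fset_set_image// card_imfset//; apply: addnI.
apply/seteqP; split=> m.
  move=> [Hm [h Hh mE]]; exists h => //; split; first exact: hstar_semigroup.
  exists (topm - m)%N; first exact/hstar_semigroup/hstar_sym.
  by have := hstar_le_top Hm; lia.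
move=> [t [Ht [s Hs rE]] <-]; rewrite rE in Hr sum_top.
have Ht' := hstarM Ht Hs Hr; rewrite addnC in Hr.
split; last by exists t.
have -> : (mstar i + t)%N = (topm - s)%N by lia.
exact/hstar_sym/(hstarM Hs Ht Hr).
Qed.

(** * Dual bases and the improved codes *)

Lemma code_sum (I : Type) (r : seq I) (p : pred I) m (c : I -> K)
    (u : I -> 'rV[K]_n) : (forall i, p i -> c i != 0 -> code m (u i)) ->
  code m (\sum_(i <- r | p i) c i *: u i).
Proof.
move=> Cu; apply: big_rec => [|i v pi Cv]; first exact: code0.
have [->|ci0] := eqVneq (c i) 0; first by rewrite scale0r add0r.
by rewrite addrC; apply: codeZD => //; apply: Cu.
Qed.

Lemma form_mulmx (s t : nat) (A : 'M[K]_(s, n)) (B : 'M[K]_(t, n)) i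
    (j : 'I_t) :
  (A *m (diag_mx x *m B^T)) i j = form (row i A) (row j B).
Proof.
rewrite mulmxA mul_mx_diag !mxE; apply: eq_bigr => l _.
by rewrite !mxE; congr (_ * _); rewrite mulrC.
Qed.

Section DualBasis.

Variable f : 'I_n -> F.
Hypothesis f_adapted : adapted P Q f.

Let E : 'M[K]_n := \matrix_i ev P (f i).

(** In a nontrivial vanishing combination, the term of largest index would evaluate into the
    preceding code, against [hstar_pole]. *)
Let E_unit : E \in unitmx.
Proof.
rewrite -row_free_unit -kermx_eq0; apply/eqP/row_matrixP => r.
rewrite row0; set c := row r _.
have cE : c *m E = 0 by rewrite -row_mul mulmx_ker row0.
apply: contrapT => /eqP /rV0Pn[i0 ci0].
case: (@arg_maxnP _ i0 (fun i => c 0 i != 0) (@nat_of_ord n) ci0) => i ci i_max.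
have [Rf fi] := f_adapted i.
apply: (hstar_pole (mstar_hstar (ltn_ord i)) Rf fi).
have /eqP := cE; rewrite mulmx_sum_row (bigD1 i)//= rowK addr_eq0 => /eqP cfi.
rewrite -[ev _ _](scalerK ci) cfi scalerN -scaleNr -[X in code _ X]add0r.
apply: codeZD; first exact: code0.
apply: code_sum => l neji cj; rewrite rowK.
have lt_ji : (l < i)%N by rewrite ltn_neqAle neji; apply: i_max.
have [Rj fj] := f_adapted l; apply/code_ev/(L_le _ (pole_L Rj fj)).
suff : (mstar l < mstar i)%N by lia.
by rewrite ltnNge; apply/negP => /cnt_le; rewrite !cnt_mstar// leqNgt lt_ji.
Qed.

(* The basis dual to [ev f_1, ..., ev f_n] is triangular for the filtration   *)
(* by the codes [C(D, m_i Q)], hence consists of evaluations of functions     *)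
(* with the same pole orders.                                                 *)
Lemma dual_adapted : exists2 f' : 'I_n -> F, adapted P Q f' &
  forall i (j : 'I_n), form (ev P (f' i)) (ev P (f j)) = (j == rev_ord i)%:R.
Proof.
pose J : 'M[K]_n := \matrix_(i, j) (j == rev_ord i)%:R.
pose D := diag_mx x *m E^T.
have D_unit : D \in unitmx.
  rewrite unitmx_mul unitmx_tr E_unit andbT unitmxE det_diag unitfE.
  by apply/prodf_neq0.
pose w i := row i (J *m invmx D).
have wE i (j : 'I_n) : form (w i) (ev P (f j)) = (j == rev_ord i)%:R.
  have <- : (J *m invmx D *m D) i j = (j == rev_ord i)%:R.
    by rewrite mulmxKV// mxE.
  by rewrite form_mulmx rowK.
have w_code (i : 'I_n) : code (mstar i)%:Z (w i).
  (* It suffices that [w i] be orthogonal to the code just below index [rev_ord i]. By [L_ind] this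
     is checked on the [f o] of smaller index and, for orders in H \ H^*, on functions with zero
     evaluation. *)
  apply: (@code_form _ ((mstar (rev_ord i))%:Z - 1)).
    have -> : (mstar i)%:Z = (mstar i).+1%:Z - 1 by lia.
    rewrite !dim_codev cntS_hstar; last exact: mstar_hstar.
    by rewrite !cnt_mstar//=; have := ltn_ord i; lia.
  move=> _ [h Lh <-].
  suff [] : RRinf Q h /\ form (w i) (ev P h) = 0 by [].
  move: h Lh; apply: (@L_ind [set h | RRinf Q h /\ form (w i) (ev P h) = 0]).
    split=> [|c h h' [Rh h0] [Rh' h0']].
      by split; [exists 0%N => //; apply: (L_closed _).1|rewrite ev0 form0r].
    rewrite /= evZD// formZDr h0 h0' mulr0 addr0; split=> //.
    by apply/RRinfP => R neRQ; apply: vgeD; [|apply: vgeZ]; apply: (RRinfP _).1.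
  move=> j lt_j Hj.
  have [Hsj|/(not_hstar Hj)[h [Rh hj ev_h]]] := pselect (Hstar j).
    have [mj lt_cj] := cnt_hstar Hsj; pose o := Ordinal lt_cj.
    have [Rf fo] := f_adapted o; rewrite /= mj in fo.
    exists (f o); split=> //; split=> //; rewrite wE.
    by case: eqP => // oE; move: lt_j; rewrite -oE /= mj ltnn.
  by exists h; split=> //; split=> //; rewrite ev_h form0r.
have /choice[f' f'P] : forall i : 'I_n, exists h,
    L (mstar i)%:Z h /\ ev P h = w i.
  by move=> i; have [h] := w_code i; exists h.
exists f' => [i|i j]; last by rewrite (f'P i).2 wE.
have [Lf' ev_f'] := f'P i; split; first exact: L_RRinf Lf'.
(* A smaller pole order would make the pairing with [f (rev_ord i)] vanish by dimensions, but it
   equals 1. *)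
apply: L_pole => // Lf1; have [Rf fr] := f_adapted (rev_ord i).
have /eqP := wE i (rev_ord i); rewrite eqxx -ev_f'.
rewrite (@code_form0 ((mstar i)%:Z - 1) (mstar (rev_ord i))%:Z).
- by rewrite eq_sym oner_eq0.
- have -> : (mstar (rev_ord i))%:Z = (mstar (rev_ord i)).+1%:Z - 1 by lia.
  rewrite !dim_codev cntS_hstar; last exact: mstar_hstar.
  by rewrite !cnt_mstar//=; have := ltn_ord i; lia.
- exact: code_ev.
- exact/code_ev/pole_L.
Qed.

End DualBasis.

(** The coordinates of u in the basis [e] are its pairings with [w] in reverse order, so u is
    orthogonal to the chosen [w i] exactly when the matching coordinates vanish. *)
Lemma chi_span_dual (e w : 'I_n -> 'rV[K]_n) (S : pred 'I_n) :
  (forall i (j : 'I_n), form (e i) (w j) = (j == rev_ord i)%:R) ->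
  chi x @` [set` <<[seq e i | i <- enum 'I_n & ~~ S (rev_ord i)]>>%VS] =
  dual [set` <<[seq w i | i <- enum 'I_n & S i]>>%VS].
Proof.
move=> ewE; apply/seteqP; split=> [_ [u /= eu <-]|v dv].
  apply/dual_chiP => v /= wv.
  move: u eu; apply: (@span_ind [set u | form u v = 0]) => /=.
  - by rewrite formC form0r.
  - by move=> c u u' u0 u'0; rewrite formZDl u0 u'0 mulr0 addr0.
  move=> _ /mapP[i + ->]; rewrite mem_filter => /andP[nSi _].
  move: v wv; apply: (@span_ind [set v | form (e i) v = 0]) => /=.
  - exact: form0r.
  - by move=> c u u' u0 u'0; rewrite formZDr u0 u'0 mulr0 addr0.
  move=> _ /mapP[j + ->]; rewrite mem_filter => /andP[Sj _].
  by rewrite ewE; case: eqP => // jE; rewrite jE (negPf nSi) in Sj.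
pose u : 'rV[K]_n := \row_i (v 0 i / x 0 i).
have uE : chi x u = v.
  by apply/rowP => i; rewrite !mxE mulrC divfK.
exists u => //; rewrite -uE in dv; move/dual_chiP in dv.
have -> : u = \sum_i form u (w (rev_ord i)) *: e i.
  pose A : 'M[K]_n := \matrix_i e i.
  pose W : 'M[K]_n := \matrix_i w (rev_ord i).
  have /mulmx1C AW : A *m (diag_mx x *m W^T) = 1%:M.
    apply/matrixP => i j; rewrite form_mulmx !rowK ewE mxE.
    by rewrite (inj_eq rev_ord_inj) eq_sym.
  rewrite -[LHS]mulmx1 -AW mulmxA mulmx_sum_row; apply: eq_bigr => i _.
  by rewrite form_mulmx !rowK row_id.
rewrite /=; apply: memv_suml => i _.
have [Si|nSi] := boolP (S (rev_ord i)).
  rewrite dv ?scale0r ?mem0v//=; apply: memv_span; apply: map_f.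
  by rewrite mem_filter Si mem_enum.
apply: memvZ; apply: memv_span; apply: map_f.
by rewrite mem_filter nSi mem_enum.
Qed.

Lemma isometric_sym (C C' : set 'rV[K]_n) : isometric C C' -> isometric C' C.
Proof.
move=> [y [y0 <-]]; exists (\row_i (y 0 i)^-1); split=> [i|].
  by rewrite mxE invr_eq0.
have chiK u : chi (\row_i (y 0 i)^-1) (chi y u) = u.
  by apply/rowP => i; rewrite !mxE mulKf.
apply/seteqP; split=> [_ [_ [u Cu <-] <-]|u Cu]; first by rewrite chiK.
by exists (chi y u); [exists u|].
Qed.

Lemma chi_improved_code (e w : 'I_n -> F) (delta : nat) :
  (forall i (j : 'I_n), form (ev P (e i)) (ev P (w j)) = (j == rev_ord i)%:R) ->
  chi x @` improved_code P Q e delta = improved_dual_code P Q w delta.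
Proof.
move=> ewE; pose S i := (#|` fset_set (Aset Q (mstar i))| < delta)%N.
rewrite /improved_code (@eq_filter _ _ (fun i => ~~ S (rev_ord i))) => [|i].
  exact: (chi_span_dual (fun i => S (nat_of_ord i)) ewE).
by rewrite card_Lambda_star leqNgt.
Qed.

End IsometryDual.

End OnePoint.

Theorem proposition4p16 (K : finFieldType) (F : fieldType)
  (iota : {rmorphism K -> F}) (g n delta : nat)
  (Q : closed_point iota) (P : 'I_n -> closed_point iota) :
  curve iota -> genus iota g ->
  rational Q -> (forall i, rational (P i)) ->
  injective P -> (forall i, P i <> Q) ->
  (2 * g + 2 < n)%N ->
  (1 <= delta <= n)%N ->
  isometry_dual (code_seq P Q) ->
  (forall f : 'I_n -> F, adapted P Q f ->
     exists2 f' : 'I_n -> F, adapted P Q f' &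
       isometric (improved_dual_code P Q f delta) (improved_code P Q f' delta))
  /\
  (forall f : 'I_n -> F, adapted P Q f ->
     exists2 f' : 'I_n -> F, adapted P Q f' &
       isometric (improved_code P Q f delta) (improved_dual_code P Q f' delta)).
Proof.
move=> _ genus_g ratQ ratP injP PQ n_gt _ [x [x0 x_dual]].
have dual_f f (f_adapted : adapted P Q f) :=
  dual_adapted genus_g ratQ ratP injP PQ n_gt x0 x_dual f_adapted.
have chi_code := chi_improved_code genus_g ratQ ratP injP PQ n_gt x0 x_dual.
split=> f /dual_f[f' f'_adapted f'E]; exists f' => //.
  by apply: isometric_sym; exists x; split=> //; apply: chi_code.
(* As [form] is symmetric and [rev_ord] an involution, [f] is in turn the dual basis of [f']. *)
exists x; split=> //; apply: chi_code => i j.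
by rewrite formC f'E -(inj_eq rev_ord_inj) rev_ordK eq_sym.
Qed.
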